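(* The expected values $E_N^{rat}$ and $E_N^{rat-sym}$ of the $N$th rational complexity and of the $N$th symmetric rational complexity satisfy $$E_N^{rat-sym}\le E_N^{rat}-\frac{3N}{8}+O(1).$$ That is, there is an absolute constant $C$ such that $E_N^{rat-sym}\le E_N^{rat}-\frac{3N}{8}+C$ for all integers $N\ge 2$.
   Context: For a binary vector $\mathcal{S}_N=(s_0,\ldots,s_{N-1})\in\{0,1\}^N$, the $N$th rational complexity is $$\Lambda(\mathcal{S}_N)=\min\left\{\max\{q,|f|\}: q\sum_{n=0}^{N-1}s_n2^n\equiv f\bmod 2^N,\ q>0 \mbox{ odd}\right\},$$ where $q,f$ range over integers. The reverse of $\mathcal{S}_N$ is $\mathcal{S}_N^{rev}=(s_{N-1},s_{N-2},\ldots,s_0)$. For $N\ge 2$ the symmetric rational complexity is $\Lambda^{sym}(\mathcal{S}_N)=\min\{\Lambda(\mathcal{S}_N),\Lambda(\mathcal{S}_N^{rev})\}$. The expected values are $$E_N^{rat}=\frac{1}{2^N}\sum_{\mathcal{S}_N\in\{0,1\}^N}\Lambda(\mathcal{S}_N),\qquad E_N^{rat-sym}=\frac{1}{2^N}\sum_{\mathcal{S}_N\in\{0,1\}^N}\Lambda^{sym}(\mathcal{S}_N).$$ *)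

(* Defs.v *)
From mathcomp Require Import all_boot all_order all_algebra.
From mathcomp Require Import boolp.

Set Implicit Arguments.
Unset Strict Implicit.
Unset Printing Implicit Defensive.

Import Order.TTheory GRing.Theory Num.Theory.
Local Open Scope ring_scope.

Definition dyadic_val (N : nat) (s : N.-tuple bool) : int :=
  \sum_(n < N) (tnth s n)%:R * 2 ^+ n.

Definition rat_height (N : nat) (s : N.-tuple bool) (m : nat) : Prop :=
  exists q f : int,
    [/\ 0 < q, odd `|q|%N, (q * dyadic_val s = f %[mod 2 ^+ N])%Z
      & m%:Z = Num.max q `|f|].

Lemma rat_height_ex (N : nat) (s : N.-tuple bool) :
  exists m : nat, `[< rat_height s m >].
Proof.
exists (absz (Num.max 1 `|dyadic_val s|)); apply/asboolP.
exists 1, (dyadic_val s); split=> //; first by rewrite mul1r.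
by rewrite gez0_abs // le_max.
Qed.

(* The minimum of [rat_height s]; [`[< _ >]] is the classical reflection of a
   proposition into [bool] that [ex_minn] requires. *)
Definition ratc (N : nat) (s : N.-tuple bool) : nat := ex_minn (rat_height_ex s).

Definition ratc_sym (N : nat) (s : N.-tuple bool) : nat :=
  minn (ratc s) (ratc (rev_tuple s)).

Definition E_rat (N : nat) : rat :=
  (2 ^+ N)^-1 * \sum_(s : N.-tuple bool) (ratc s)%:R.

Definition E_rat_sym (N : nat) : rat :=
  (2 ^+ N)^-1 * \sum_(s : N.-tuple bool) (ratc_sym s)%:R.

(* Main.v *)
Require Import Defs.
From mathcomp Require Import all_boot all_order all_algebra.
From mathcomp Require Import boolp.
From mathcomp Require Import zify ring lra.
Import Order.TTheory GRing.Theory Num.Theory.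
Local Open Scope ring_scope.

Set Implicit Arguments.
Unset Strict Implicit.
Unset Printing Implicit Defensive.

(* If s starts with exactly k copies of the bit b, it agrees 2-adically with
   the integer -b to exactly k places, so every admissible f/q satisfies
   |f| + b q >= 2^k and hence Lambda(s) >= 2^k / (1 + b).  The reverse of s is
   congruent modulo 2^N to an integer of size at most 2^(N-k).  There are
   2^(N-k-1) such s for each b, so for every k >= N/2 the two values of b
   together contribute 1/2 + 1/4 - O(4^(N-k) / 2^N) to E_rat - E_rat_sym, and
   there are about N/2 such k. *)

(** Working on plain sequences lets a word be split at the end of a run, or reversed, without tuple
    casts. *)
Fixpoint dval (s : seq bool) : int :=
  if s is b :: s' then (b%:R : int) + 2 * dval s' else 0.

Lemma dyadic_valE (N : nat) (s : N.-tuple bool) : dyadic_val s = dval s.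
Proof.
rewrite /dyadic_val; elim: N s => [|N IH] s; first by rewrite tuple0 big_ord0.
case/tupleP: s => b s; rewrite big_ord_recl tnth0 expr0 mulr1 /= -IH mulr_sumr.
by congr (_ + _); apply: eq_bigr => i _; rewrite tnthS exprS mulrCA.
Qed.

Lemma dval_cat (s t : seq bool) : dval (s ++ t) = dval s + 2 ^+ size s * dval t.
Proof.
elim: s => [|b s IH] /=; first by rewrite expr0 mul1r add0r.
by rewrite IH exprS; ring.
Qed.

Lemma dval_nseq (k : nat) (b : bool) : dval (nseq k b) = b%:R * (2 ^+ k - 1).
Proof.
elim: k => [|k IH] /=; first by rewrite expr0; ring.
by rewrite IH exprS; ring.
Qed.

Lemma dval_bounds (s : seq bool) : 0 <= dval s < 2 ^+ size s.
Proof.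
elim: s => [|b s /andP[IH1 IH2]] //=; rewrite exprS.
by case: b => /=; lia.
Qed.

Lemma ratc_le (N : nat) (s : N.-tuple bool) (m : nat) :
  rat_height s m -> (ratc s <= m)%N.
Proof. by rewrite /ratc; case: ex_minnP => r _ + /asboolP; apply. Qed.

Lemma rat_height_ratc (N : nat) (s : N.-tuple bool) : rat_height s (ratc s).
Proof. by rewrite /ratc; case: ex_minnP => r /asboolP. Qed.

(** The closing bit [~~ b] makes the run length exactly [k]. This is what makes the cofactor in
    [ratc_run_ge] odd and keeps different runs disjoint. *)
Definition run_prefix (k : nat) (b : bool) : seq bool :=
  rcons (nseq k b) (~~ b).

Lemma prefix_runP (k : nat) (b : bool) (s : seq bool) :
  prefix (run_prefix k b) s -> exists t, s = nseq k b ++ ~~ b :: t.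
Proof. by case/prefixP => t ->; exists t; rewrite cat_rcons. Qed.

Lemma ratc_run_ge (N k : nat) (b : bool) (s : N.-tuple bool) :
  (k < N)%N -> prefix (run_prefix k b) s -> (2 ^ k <= b.+1 * ratc s)%N.
Proof.
move=> kN /prefix_runP[t st].
have [q [f [q0 qodd /eqP qf mE]]] := rat_height_ratc s.
move: qf; rewrite eqz_mod_dvd dyadic_valE st dval_cat size_nseq dval_nseq /=.
case/dvdzP => c cE.
have N2 : 2 ^+ N = 2 ^+ k * (2 * 2 ^+ (N - k.+1)) :> int.
  by rewrite -exprS -exprD; congr (_ ^+ _); lia.
(* The run and its closing bit contribute $b + (1-b) = 1$ times $q$, and all other terms in the
   cofactor of $2^k$ are even, the one in [c] because $k < N$. As [q] is odd, so is the cofactor,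
   which is therefore nonzero. *)
have fq : f + b%:R * q = 2 ^+ k * (q + 2 * (q * (dval t - b%:R + b%:R)
     - c * 2 ^+ (N - k.+1))).
  have -> : f = q * (b%:R * (2 ^+ k - 1) + 2 ^+ k * ((~~ b)%:R + 2 * dval t))
     - c * 2 ^+ N by rewrite -cE; ring.
  by rewrite N2; case: (b) => /=; ring.
have k0 : 0 < 2 ^+ k :> int by apply: exprn_gt0.
have := congr1 (fun x : int => `|x|) fq; rewrite normrM (gtr0_norm k0).
set u := q + _; have u1 : 1 <= `|u| by rewrite /u; lia.
move=> fqE; have kle : 2 ^+ k <= `|f + b%:R * q| by rewrite fqE; nia.
have kE : (2 ^ k)%N%:Z = 2 ^+ k by rewrite -natrX natz.
case: (b) kle => /= kle; lia.
Qed.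

(** After reversal the run fills the top $k$ places and is worth $b(2^N - 2^{N-k})$, which is
    $-b\,2^{N-k}$ modulo $2^N$. The low part [r] lies in $[0, 2^{N-k})$, so $q = 1$ and $f = r -
    b\,2^{N-k}$ are good enough. *)
Lemma ratc_rev_run_le (N k : nat) (b : bool) (s : N.-tuple bool) :
  prefix (run_prefix k b) s -> (ratc (rev_tuple s) <= 2 ^ (N - k))%N.
Proof.
move=> /prefix_runP[t st].
have sz : (N = k + (size t).+1)%N.
  by rewrite -(size_tuple s) st size_cat size_nseq.
set r := dval (rev (~~ b :: t)).
have rb := dval_bounds (rev (~~ b :: t)); rewrite -/r size_rev /= in rb.
have NkE : (N - k = (size t).+1)%N by lia.
have j0 : 1 <= 2 ^+ (size t).+1 :> int by apply: exprn_ege1.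
have jE : (2 ^ (size t).+1)%N%:Z = 2 ^+ (size t).+1 by rewrite -natrX natz.
set f := r - b%:R * 2 ^+ (size t).+1.
have fle : `|f| <= 2 ^+ (size t).+1 by rewrite /f; case: (b) => /=; lia.
apply: (@leq_trans (absz (Num.max 1 `|f|))); last first.
  by rewrite NkE; case: (leP 1 `|f|); lia.
apply: ratc_le; exists 1, f; split => //; last by rewrite gez0_abs // le_max.
rewrite mul1r dyadic_valE /= st rev_cat rev_nseq dval_cat size_rev dval_nseq.
rewrite -/r /=.
apply/eqP; rewrite eqz_mod_dvd; apply/dvdzP; exists b%:R.
by rewrite /f sz exprD; ring.
Qed.

Lemma card_prefix (T : finType) (N : nat) (p : seq T) : (size p <= N)%N ->
  #|[pred s : N.-tuple T | prefix p s]| = (#|T| ^ (N - size p))%N.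
Proof.
elim: p N => [|x p IH] N /=.
  rewrite subn0 -card_tuple => _; apply: eq_card => s.
  by rewrite !inE prefix0s.
case: N => // N pN; rewrite subSS -IH //.
have cons_inj : injective (fun t : N.-tuple T => cons_tuple x t).
  by move=> t u /(congr1 val) [] /val_inj.
rewrite -(card_image cons_inj); apply: eq_card => s; rewrite !inE.
apply/idP/imageP => [|[t pt ->]]; last by rewrite /= eqxx.
case/tupleP: s => y s /= /andP[/eqP <- ps].
by exists s => //; apply: val_inj.
Qed.

Lemma card_run (N k : nat) (b : bool) : (k < N)%N ->
  #|[pred s : N.-tuple bool | prefix (run_prefix k b) s]| = (2 ^ (N - k.+1))%N.
Proof.
by move=> kN; rewrite card_prefix size_rcons size_nseq // card_bool.
Qed.

(** For a nonempty run, [b] is the first bit of [s] and [k] the position of the first bit that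
    differs from it. An empty run would be confused with a run of the opposite bit. *)
Lemma run_prefix_inj (k l : nat) (b c : bool) (s : seq bool) :
  (0 < k)%N -> (0 < l)%N ->
  prefix (run_prefix k b) s -> prefix (run_prefix l c) s -> (k, b) = (l, c).
Proof.
have runE m d : (0 < m)%N -> prefix (run_prefix m d) s ->
    (find (predC1 (head false s)) s, head false s) = (m, d).
  case: m => // m _ /prefix_runP[t ->].
  rewrite [head _ _]/= find_cat has_nseq size_nseq /=.
  by rewrite eqxx /=; case: d => /=; rewrite addn0.
by move=> k0 l0 /(runE _ _ k0) <- /(runE _ _ l0) <-.
Qed.

(** After exchanging the sums, each [g x] is counted at most once. *)
Lemma sum_disjoint_le (R : numDomainType) (I T : finType) (P : I -> pred T)
    (g : T -> R) :
  (forall x, 0 <= g x) -> (forall i j x, P i x -> P j x -> i = j) ->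
  \sum_i \sum_(x | P i x) g x <= \sum_x g x.
Proof.
move=> g0 Pinj; under eq_bigr => i _ do rewrite big_mkcond.
rewrite exchange_big; apply: ler_sum => x _.
case: (pickP (P^~ x)) => [i Pix|P0]; last by rewrite big1 // => i _; rewrite P0.
rewrite (bigD1 i) //= Pix big1 ?addr0 // => j ji.
by case: ifP => // Pjx; rewrite (Pinj _ _ _ Pjx Pix) eqxx in ji.
Qed.

Definition gain (N : nat) (s : N.-tuple bool) : rat :=
  (ratc s)%:R - (ratc_sym s)%:R.

Lemma gain_ge0 (N : nat) (s : N.-tuple bool) : 0 <= gain s.
Proof. by rewrite subr_ge0 ler_nat geq_minl. Qed.

Lemma gain_run (N k : nat) (b : bool) (s : N.-tuple bool) :
  (k < N)%N -> prefix (run_prefix k b) s ->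
  2 ^+ k / b.+1%:R - 2 ^+ (N - k) <= gain s.
Proof.
move=> kN ps; apply: lerB.
  rewrite ler_pdivrMr ?ltr0n // -natrX -natrM ler_nat mulnC.
  exact: ratc_run_ge.
rewrite -natrX ler_nat; apply: leq_trans (ratc_rev_run_le ps).
exact: geq_minr.
Qed.

(** Here [j] is the number of free bits after the closing bit, so each [b] has $2^j$ words. With $k
    = N-j-1$, the main terms give $(1 + 1/2)\,2^k 2^j = \frac34 2^N$ and the errors $2 \cdot 2^{j+1}
    2^j = 4^{j+1}$. *)
Lemma sum_gain_run (N j : nat) : (j < N)%N ->
  3 / 4 * 2 ^+ N - 4 ^+ j.+1 <=
  \sum_(b : bool) \sum_(s : N.-tuple bool | prefix (run_prefix (N - j.+1) b) s)
    gain s.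
Proof.
move=> jN; have kN : (N - j.+1 < N)%N by lia.
have -> : 3 / 4 * 2 ^+ N - 4 ^+ j.+1 = \sum_(b : bool)
   \sum_(s : N.-tuple bool | prefix (run_prefix (N - j.+1) b) s)
     (2 ^+ (N - j.+1) / b.+1%:R - 2 ^+ j.+1) :> rat.
  transitivity (\sum_(b : bool)
      (2 ^+ (N - j.+1) / b.+1%:R - 2 ^+ j.+1) * 2 ^+ j : rat).
    have NE : N = ((N - j.+1) + j.+1)%N by lia.
    rewrite big_bool /= {1}NE exprD !exprS -[4]/(2 * 2 : rat) exprMn.
    by field.
  apply: eq_bigr => b _; rewrite sumr_const card_run // -[RHS]mulr_natr natrX.
  by congr (_ * _ ^+ _); lia.
apply: ler_sum => b _; apply: ler_sum => s ps.
have {2}-> : (j.+1 = N - (N - j.+1))%N by lia.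
exact: gain_run.
Qed.

Lemma sum_gain_ge (N : nat) : (2 <= N)%N ->
  (3 / 8 * N%:R - 2) * 2 ^+ N <= \sum_(s : N.-tuple bool) gain s.
Proof.
(* Taking $j < h$ keeps every run nonempty and the geometric sum of the errors $4^{j+1}$ within
   $\frac43 4^h \le \frac43 2^N$. *)
move=> N2; set h := N./2; have hN : (h.*2 <= N <= h.*2.+1)%N by lia.
pose P (p : 'I_h * bool) (s : N.-tuple bool) :=
  prefix (run_prefix (N - p.1.+1) p.2) s.
have Pinj p p' s : P p s -> P p' s -> p = p'.
  case: p p' => [i b] [j c] /= Ps Ps'.
  have k0 (m : 'I_h) : (0 < N - m.+1)%N by have := ltn_ord m; lia.
  have [ij ->] := run_prefix_inj (k0 i) (k0 j) Ps Ps'.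
  by congr (_, _); apply: ord_inj; have := ltn_ord i; have := ltn_ord j; lia.
apply: le_trans (sum_disjoint_le (@gain_ge0 N) Pinj).
rewrite -(pair_bigA _ (fun i b => \sum_(s | P (i, b) s) gain s)) /=.
apply: (@le_trans _ _ (\sum_(i < h) (3 / 4 * 2 ^+ N - 4 ^+ i.+1))); last first.
  by apply: ler_sum => i _; apply: sum_gain_run; have := ltn_ord i; lia.
have geo : \sum_(i < h) 4 ^+ i.+1 = 4 / 3 * (4 ^+ h - 1) :> rat.
  elim: (h) => [|m IH]; first by rewrite big_ord0 expr0; ring.
  by rewrite big_ord_recr IH /= !exprS; field.
have h4 : 4 ^+ h <= 2 ^+ N :> rat.
  have -> : 4 = 2 ^+ 2 :> rat by [].
  by rewrite -exprM ler_weXn2l //; lia.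
rewrite sumrB geo sumr_const card_ord -mulr_natr.
have NE : N%:R <= 2 * h%:R + 1 :> rat by rewrite -natrM natr1 ler_nat; lia.
have p0 : 0 < 2 ^+ N :> rat by apply: exprn_gt0.
(* Relative to $2^N$, the bound $h \ge (N-1)/2$ costs $3/8$ and the errors cost at most $4/3$,
   together less than 2. *)
nra.
Qed.

Theorem proposition2 :
  exists C : rat, forall N : nat, (2 <= N)%N ->
    E_rat_sym N <= E_rat N - 3 * N%:R / 8 + C.
Proof.
exists 2 => N N2; have := sum_gain_ge N2.
have p0 : 0 < 2 ^+ N :> rat by apply: exprn_gt0.
rewrite sumrB -ler_pdivlMr // /E_rat_sym /E_rat mulrBl ![_ / 2 ^+ N]mulrC.
by lra.
Qed.
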